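(* Let $(D,\le)$ be a totally ordered set. For every finite list $X$ over $D$, $$\mathcal{M}[\mathrm{PatSort1}[X]]=\mathcal{M}[X],$$ i.e. the list $\mathrm{PatSort1}[X]$ contains exactly the same elements as $X$ with the same multiplicities.
   Context: Lists are finite lists over a totally ordered set $(D,\le)$. $\langle\rangle$ is the empty list, $a\smile U$ is the list with head $a$ and tail $U$, $U\frown a$ is the list obtained by appending the element $a$ at the end of $U$. $\mathrm{head}$ and $\mathrm{last}$ give the first and last element of a nonempty list. $\mathcal{M}[U]$ is the multiset of the elements of the list $U$ (with multiplicities). $\mathrm{Merge}$ is the usual merge: $\mathrm{Merge}[\langle\rangle,V]=V$, $\mathrm{Merge}[U,\langle\rangle]=U$, $\mathrm{Merge}[a\smile U,b\smile V]=a\smile \mathrm{Merge}[U,b\smile V]$ if $a\le b$, and $=b\smile\mathrm{Merge}[a\smile U,V]$ otherwise. $\mathrm{SelSorted}$ and $\mathrm{SelRest}$ are defined by recursion on the list: - $\mathrm{SelSorted}[\langle\rangle]=\langle\rangle$, $\mathrm{SelRest}[\langle\rangle]=\langle\rangle$; - $\mathrm{SelSorted}[a\smile\langle\rangle]=a\smile\langle\rangle$, $\mathrm{SelRest}[a\smile\langle\rangle]=\langle\rangle$; - for $U$ nonempty, writing $S=\mathrm{SelSorted}[U]$ (which is nonempty) and $R=\mathrm{SelRest}[U]$: if $a\le \mathrm{head}[S]$ then $\mathrm{SelSorted}[a\smile U]=a\smile S$ and $\mathrm{SelRest}[a\smile U]=R$; otherwise, if $\mathrm{last}[S]\le a$ then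 $\mathrm{SelSorted}[a\smile U]=S\frown a$ and $\mathrm{SelRest}[a\smile U]=R$; otherwise (i.e. $\mathrm{head}[S]<a<\mathrm{last}[S]$) $\mathrm{SelSorted}[a\smile U]=S$ and $\mathrm{SelRest}[a\smile U]=a\smile R$. $\mathrm{PatSort1}$ is defined by $\mathrm{PatSort1}[\langle\rangle]=\langle\rangle$ and $\mathrm{PatSort1}[a\smile U]=\mathrm{Merge}[\mathrm{PatSort1}[\mathrm{SelRest}[a\smile U]],\ \mathrm{SelSorted}[a\smile U]]$ (the recursive call is on a strictly shorter list). *)

(* Defs.v *)
From Stdlib Require Import Wf_nat.
From mathcomp Require Import all_boot all_order.
From mathcomp.finmap Require Export multiset.

Set Implicit Arguments.
Unset Strict Implicit.
Unset Printing Implicit Defensive.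

Import Order.TTheory.
Local Open Scope order_scope.

Section PatSort.

Context {disp : Order.disp_t} {D : orderType disp}.
Implicit Types (a : D) (U V X : seq D).

Definition Merge U V : seq D := merge <=%O U V.

(* In the last case SelSorted U is nonempty (SelSorted_cons_neq0), so that
   head a S and last a S do not depend on the default value a. *)
Fixpoint SelSorted X : seq D :=
  match X with
  | [::] => [::]
  | [:: a] => [:: a]
  | a :: (_ :: _) as U =>
      let S := SelSorted U in
      if a <= head a S then a :: S
      else if last a S <= a then rcons S a
      else S
  end.

Fixpoint SelRest X : seq D :=
  match X with
  | [::] => [::]
  | [:: a] => [::]
  | a :: (_ :: _) as U =>
      let S := SelSorted U in
      let R := SelRest U in
      if a <= head a S then R
      else if last a S <= a then R
      else a :: R
  end.

Lemma SelSorted_cons_neq0 a U : SelSorted (a :: U) <> [::].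
Proof.
elim: U a => [|b U IHU] a //=.
case: ifP => // _; case: ifP => [_|_]; last exact: IHU.
by case: (X in rcons X).
Qed.

Lemma size_SelRest a U : (size (SelRest (a :: U)) < size (a :: U))%N.
Proof.
elim: U a => [|b U IHU] a //.
have {IHU}lt_bU := IHU b.
rewrite [SelRest _]/=; case: ifP => _; first exact: ltnW.
by case: ifP => _; first exact: ltnW.
Qed.

Lemma ltof_SelRest a U : ltof _ size (SelRest (a :: U)) (a :: U).
Proof. exact/ssrnat.ltP/size_SelRest. Qed.

Definition PatSort1_step X :
    (forall V, ltof _ size V X -> seq D) -> seq D :=
  match X with
  | [::] => fun=> [::]
  | a :: U => fun rec =>
      Merge (rec (SelRest (a :: U)) (ltof_SelRest a U)) (SelSorted (a :: U))
  end.

Definition PatSort1 : seq D -> seq D :=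
  Fix (well_founded_ltof _ size) (fun=> seq D) PatSort1_step.

Lemma PatSort1E X :
  PatSort1 X = if X is a :: U
               then Merge (PatSort1 (SelRest (a :: U))) (SelSorted (a :: U))
               else [::].
Proof.
rewrite {1}/PatSort1 Fix_eq; first by case: X.
by case=> [|a U] f g eq_fg //=; rewrite eq_fg.
Qed.

Lemma Merge_nil_l V : Merge [::] V = V. Proof. by []. Qed.

Lemma Merge_nil_r U : Merge U [::] = U. Proof. by case: U. Qed.

Lemma Merge_cons a U b V :
  Merge (a :: U) (b :: V) =
    if a <= b then a :: Merge U (b :: V) else b :: Merge (a :: U) V.
Proof. by []. Qed.

End PatSort.

(* Main.v *)
Require Import Defs.
From mathcomp Require Import all_boot all_order.

(** A selection pass puts each element into exactly one of [SelRest] and [SelSorted], so their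
    concatenation permutes the input ([perm_SelRest_SelSorted]). Merging permutes a concatenation,
    so induction on length gives [perm_PatSort1]. *)

Lemma perm_SelRest_SelSorted {disp : Order.disp_t} {D : orderType disp}
    (X : seq D) :
  perm_eq (SelRest X ++ SelSorted X) X.
Proof.
elim: X => [|a [|b U] IHU] //.
set S := SelSorted (b :: U) in IHU; set R := SelRest (b :: U) in IHU.
(* Unfolds one step of both recursions, keeping the results on [b :: U] folded as [S] and [R]. *)
change (perm_eq
  ((if (a <= head a S)%O then R else if (last a S <= a)%O then R else a :: R) ++
   (if (a <= head a S)%O then a :: S
    else if (last a S <= a)%O then rcons S a else S)) [:: a, b & U]).
case: ifP => _; last case: ifP => _; last by rewrite /= perm_cons.
- by rewrite -cat1s perm_catCA /= perm_cons.
- by rewrite -rcons_cat perm_rcons perm_cons.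
Qed.

Lemma perm_PatSort1 {disp : Order.disp_t} {D : orderType disp} (X : seq D) :
  perm_eq (PatSort1 X) X.
Proof.
elim: {X}(size X).+1 {-2}X (ltnSn (size X)) => // n IHn [|a U] ltUn;
  rewrite PatSort1E //.
(* Both sides become concatenations ending in [SelSorted (a :: U)]; cancelling it leaves the claim
   for the shorter [SelRest (a :: U)]. *)
rewrite /Merge perm_merge -(permPr (perm_SelRest_SelSorted (a :: U))).
by rewrite perm_cat2r IHn // (leq_trans (size_SelRest a U)).
Qed.

Theorem theorem1 (disp : Order.disp_t) (D : orderType disp) (X : seq D) :
  seq_mset (PatSort1 X) = seq_mset X.
Proof. exact/eq_seq_msetP/perm_PatSort1. Qed.
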